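(* Let $\mathcal{H}$ be a complex Hilbert space and let $T\in\mathcal{B}(\mathcal{H})$. Then for all $\alpha\in[0,1]$, $$w^2(T)\leq\left\|\alpha|T|+(1-\alpha)|T^*|\right\|\,\|T\|.$$
   Context: $\mathcal{B}(\mathcal{H})$ denotes the $C^*$-algebra of all bounded linear operators on the complex Hilbert space $\mathcal{H}$, and $\|\cdot\|$ is the operator norm. For $T\in\mathcal{B}(\mathcal{H})$, $|T|=(T^*T)^{1/2}$ and $|T^*|=(TT^* )^{1/2}$. The numerical radius is $w(T)=\sup\{|\langle Tx,x\rangle|: x\in\mathcal{H},\ \|x\|=1\}$, and $w^2(T)=(w(T))^2$. *)

(* Defs.v *)
From HB Require Import structures.
From mathcomp Require Import all_boot all_order all_algebra.
From mathcomp Require Import sesquilinear complex.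
From mathcomp Require Import all_classical all_reals all_analysis.

Set Implicit Arguments.
Unset Strict Implicit.
Unset Printing Implicit Defensive.

Import Order.TTheory GRing.Theory Num.Theory.
Import numFieldNormedType.Exports.

Local Open Scope classical_set_scope.
Local Open Scope ring_scope.
Local Open Scope complex_scope.

(* A complex Hilbert space is a complete normed module over R[i] whose norm
   comes from an inner product.  The forms of sesquilinear.v are linear in the
   first argument and conjugate-linear in the second. *)
HB.mixin Record isHilbert (R : realType) H & CompleteNormedModule R[i] H := {
  inner : {dot H for Num.conj};
  normr_inner : forall x : H, `|x| ^+ 2 = inner x x
}.

#[short(type="hilbertType")]
HB.structure Definition Hilbert (R : realType) :=
  {H of CompleteNormedModule R[i] H & isHilbert R H}.

(* Norms in a normed module over R[i] are elements of R[i], with zero imaginary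
   part; rnorm is the same number in R, where suprema are available. *)
Definition rnorm (R : realType) (V : normedZmodType R[i]) (x : V) : R :=
  complex.Re `|x|.

Section Operators.
Variables (R : realType) (H : hilbertType R).
Implicit Types A B S T : H -> H.

(* The algebra B(H), as a subset of the functions H -> H. *)
Definition bounded_operator : set (H -> H) :=
  [set T | linear T /\ exists M : R, forall x, rnorm (T x) <= M * rnorm x].

Definition opnorm T : R := sup [set rnorm (T x) | x in [set x | rnorm x <= 1]].

(* The supremum of the empty set is 0 in the library, so that w(T) = 0 when
   H = {0} has no unit vector. *)
Definition numerical_radius T : R :=
  sup [set rnorm (inner (T x) x) | x in [set x | rnorm x = 1]].

(* xget 0 P is an element of P, or the zero operator if P is empty.  For T in
   B(H) exactly one S satisfies the condition, by the Riesz representation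
   theorem. *)
Definition adjoint T : H -> H :=
  xget 0 [set S | bounded_operator S /\
                  forall x y, inner (T x) y = inner x (S y)].

(* The order of R[i] makes 0 <= z say that z is real and nonnegative. *)
Definition positive_operator : set (H -> H) :=
  [set A | bounded_operator A /\ forall x, 0 <= inner (A x) x].

(* A positive A has exactly one positive square root; operators that are not
   positive get a value with no meaning. *)
Definition sqrt_operator A : H -> H :=
  xget 0 [set B | positive_operator B /\ B \o B = A].

Definition abs_operator T : H -> H := sqrt_operator (adjoint T \o T).

End Operators.

(* Main.v *)
(* Let P = |T|.  Then |T x| = |P x|, and Cauchy-Schwarz for the semidefinite
   form <P u, v> gives |P x|^4 <= <P x, x> <P P x, P x>, hence
   |T x|^2 <= ||T|| <|T| x, x>.  For a unit vector x this bounds |<T x, x>|^2,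
   and the same bound with T^* in place of T holds since
   |<T x, x>| = |<x, T^* x>|.  The convex combination of the two bounds is
   ||T|| <(alpha |T| + (1 - alpha) |T^*|) x, x>.  The adjoint exists by the
   Riesz theorem, and the square root of T^* T by the iteration
   L |-> (B + L^2)/2. *)
Require Import Defs.
From mathcomp Require Import all_boot all_order all_algebra.
From mathcomp Require Import sesquilinear complex ring lra.
From mathcomp Require Import all_classical all_reals all_analysis.
Import Order.TTheory GRing.Theory Num.Theory.
Import numFieldNormedType.Exports.

Set Implicit Arguments.
Unset Strict Implicit.
Unset Printing Implicit Defensive.

Local Open Scope ring_scope.
Local Open Scope complex_scope.

(** * Quadratic inequalities and limits at rate [1 / (n + 1)] *)

Section RealFacts.
Variable R : realType.
Implicit Types a b c : R.

(** The common source of the Cauchy-Schwarz type bounds below: evaluate the quadratic at its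
    minimizer [- b / a]. *)
Lemma discriminant_le a b c :
  0 <= a -> (forall t, 0 <= a * t ^+ 2 + 2 * b * t + c) -> b ^+ 2 <= a * c.
Proof.
move=> a0 q; have [a1|a1] := eqVneq a 0.
  have [->|b1] := eqVneq b 0; first by rewrite a1; lra.
  (* For [a = 0] this argument makes the affine function equal to [-1], a contradiction. *)
  have := q (- (c + 1) / (2 * b)); rewrite a1 mul0r add0r mulrCA mulfV ?mulr1.
    by lra.
  by rewrite mulf_neq0 // pnatr_eq0.
have {a1}a1 : 0 < a by rewrite lt0r a1.
have := q (- b / a).
have -> : a * (- b / a) ^+ 2 + 2 * b * (- b / a) + c = (a * c - b ^+ 2) / a.
  by field; rewrite gt_eqF.
by rewrite pmulr_lge0 ?invr_gt0 // subr_ge0.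
Qed.

Lemma exists_div_lt a b : 0 < b -> exists n, a / n.+1%:R < b.
Proof.
move=> b0; have [n] := ltr_add_invr (divr_gt0 b0 (ltr_pwDr ltr01 (normr_ge0 a))).
rewrite add0r => h; exists n.
rewrite ltr_pdivlMr ?ltr_pwDr ?normr_ge0 // in h.
apply: le_lt_trans h; rewrite mulrC ler_wpM2l ?invr_ge0 //.
by rewrite (le_trans (ler_norm _)) // lerDl.
Qed.

(** Stands in for passing to the limit: properties of limits are proved below by bounding a defect
    by [b / (n + 1)] for every [n]. *)
Lemma le0_of_le_div a b : (forall n, a <= b / n.+1%:R) -> a <= 0.
Proof.
move=> h; rewrite leNgt; apply/negP => a0.
by have [n] := exists_div_lt b a0; rewrite ltNge h.
Qed.

End RealFacts.

(** * The underlying real inner product, completeness, Riesz representation *)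

Section RealInnerProduct.
Variables (R : realType) (H : hilbertType R).
Implicit Types (x y z : H) (a : R).

Definition rdot x y : R := complex.Re (inner x y).

(** Conjugate-linearity in the second argument gives [<x, i y> = - i <x, y>], whose real part is the
    imaginary part of [<x, y>]. *)
Lemma inner_rdot x y : inner x y = rdot x y +i* rdot x ('i *: y).
Proof.
rewrite /rdot linearZr_LR /=; case: (inner x y) => p q /=.
by congr (_ +i* _); ring.
Qed.

Lemma rdotC x y : rdot x y = rdot y x.
Proof.
by rewrite /rdot (hermC inner) expr0 mul1r /=; case: (inner y x).
Qed.

Lemma rdotDl x y z : rdot (x + y) z = rdot x z + rdot y z.
Proof.
by rewrite /rdot linearDl /=; case: (inner x z) => p q; case: (inner y z).
Qed.

Lemma rdotNl x z : rdot (- x) z = - rdot x z.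
Proof. by rewrite /rdot linearNl /=; case: (inner x z). Qed.

Lemma rdotZl a x z : rdot (a%:C *: x) z = a * rdot x z.
Proof.
by rewrite /rdot linearZl_LR /=; case: (inner x z) => p q /=; ring.
Qed.

Lemma rdotDr x y z : rdot z (x + y) = rdot z x + rdot z y.
Proof. by rewrite rdotC rdotDl !(rdotC z). Qed.

Lemma rdotNr x z : rdot z (- x) = - rdot z x.
Proof. by rewrite rdotC rdotNl (rdotC z). Qed.

Lemma rdotZr a x z : rdot z (a%:C *: x) = a * rdot z x.
Proof. by rewrite rdotC rdotZl (rdotC z). Qed.

Lemma rdotZi x y : rdot ('i *: x) y = - rdot x ('i *: y).
Proof.
by rewrite /rdot linearZl_LR linearZr_LR /=; case: (inner x y) => p q /=; ring.
Qed.

Definition rdotE := (rdotDl, rdotDr, rdotNl, rdotNr, rdotZl, rdotZr).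

Lemma rnormC (V : normedZmodType R[i]) (v : V) : (rnorm v)%:C = `|v|.
Proof. by rewrite /rnorm RRe_real // ger0_real. Qed.

Lemma rnorm_ge0 (V : normedZmodType R[i]) (v : V) : 0 <= rnorm v.
Proof. by rewrite -ler0c rnormC. Qed.

Lemma rnormD x y : rnorm (x + y) <= rnorm x + rnorm y.
Proof. by rewrite -lecR rmorphD /= !rnormC ler_normD. Qed.

Lemma rnorm_sqr x : rnorm x ^+ 2 = rdot x x.
Proof. by rewrite /rdot -normr_inner -rnormC -rmorphXn. Qed.

Lemma rnormN x : rnorm (- x) = rnorm x.
Proof. by rewrite /rnorm normrN. Qed.

Lemma rnorm0 : rnorm (0 : H) = 0.
Proof. by rewrite /rnorm normr0. Qed.

Lemma rnormZ (c : R[i]) x : rnorm (c *: x) = rnorm c * rnorm x.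
Proof. by apply: complexI; rewrite rmorphM /= !rnormC normrZ. Qed.

Lemma rnorm_real a : 0 <= a -> rnorm a%:C = a.
Proof. by move=> a0; apply: complexI; rewrite rnormC ger0_norm // ler0c. Qed.

Lemma rnorm_eq0 x : rnorm x <= 0 -> x = 0.
Proof.
move=> h; apply/eqP; rewrite -normr_eq0 -rnormC.
by rewrite (@le_anti _ _ (rnorm x) 0) ?h ?rnorm_ge0.
Qed.

Lemma rdot_le x y : rdot x y <= rnorm x * rnorm y.
Proof.
apply: (@le_trans _ _ `|rdot x y|); first exact: ler_norm.
rewrite -(@ler_pXn2r _ 2) ?nnegrE ?mulr_ge0 ?rnorm_ge0 //.
rewrite real_normK ?num_real // exprMn !rnorm_sqr.
apply: discriminant_le => [|t]; first by rewrite -rnorm_sqr sqr_ge0.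
have := sqr_ge0 (rnorm (t%:C *: x + y)).
by rewrite rnorm_sqr !rdotE (rdotC y x); congr (_ <= _); ring.
Qed.

Lemma rdot_ge x y : - (rnorm x * rnorm y) <= rdot x y.
Proof. by rewrite lerNl -rdotNr -(rnormN y) rdot_le. Qed.

Lemma rnorm_inner_le x y : rnorm (inner x y) <= rnorm x * rnorm y.
Proof.
rewrite -(@ler_pXn2r _ 2) ?nnegrE ?mulr_ge0 ?rnorm_ge0 //.
have -> : rnorm (inner x y) ^+ 2 = rdot x y ^+ 2 + rdot x ('i *: y) ^+ 2.
  apply: complexI; rewrite rmorphXn /= rnormC -add_Re2_Im2.
  by rewrite inner_rdot.
rewrite exprMn !rnorm_sqr.
set p := rdot x y; set q := rdot x _.
have iyiy : rdot ('i *: y) ('i *: y) = rdot y y.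
  by rewrite rdotZi scalerA -expr2 sqr_i scaleN1r rdotNr opprK.
have yiy : rdot y ('i *: y) = 0.
  by have := rdotZi y y; rewrite rdotC; lra.
have [->|nz] := eqVneq (p ^+ 2 + q ^+ 2) 0.
  by rewrite mulr_ge0 // -rnorm_sqr sqr_ge0.
have s_gt0 : 0 < p ^+ 2 + q ^+ 2 by rewrite lt0r nz addr_ge0 ?sqr_ge0.
(* [w] is [<x, y> y]. Since [y] and [i y] are orthogonal for [rdot] and of equal norm, the real
   Cauchy-Schwarz inequality for [x] and [w] contains a factor [p^2 + q^2] that cancels. *)
pose w := p%:C *: y + q%:C *: ('i *: y).
have xw : rdot x w = p ^+ 2 + q ^+ 2 by rewrite /w !rdotE -!expr2.
have ww : rdot w w = (p ^+ 2 + q ^+ 2) * rdot y y.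
  by rewrite /w !rdotE iyiy (rdotC _ y) yiy; ring.
have : rdot x w ^+ 2 <= (rnorm x * rnorm w) ^+ 2.
  by rewrite ler_pXn2r ?rdot_le ?nnegrE ?mulr_ge0 ?rnorm_ge0 // xw ltW.
by rewrite exprMn !rnorm_sqr xw ww expr2 mulrCA ler_pM2l.
Qed.

Lemma cauchy_rate_limit (u : nat -> H) (C : R) :
    (forall n m, (n <= m)%N -> rnorm (u m - u n) <= C / n.+1%:R) ->
  exists l, forall n, rnorm (l - u n) <= C / n.+1%:R.
Proof.
move=> cu.
have : cauchy (u n @[n --> \oo]%classic).
  apply: cauchy_exP => eps eps0.
  have [k hk] : exists k, C / k.+1%:R < complex.Re eps.
    by apply: exists_div_lt; move: eps0; rewrite ltcE => /andP[].
  exists (u k); exists k => // n /= kn.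
  rewrite -ball_normE /ball_ /= distrC -rnormC -(@RRe_real _ eps) ?gtr0_real //.
  by rewrite ltcR (le_lt_trans _ hk) // cu.
move/cauchy_cvgP/cvg_ex => [l /= /cvgrPdist_le ul]; exists l => n.
apply/ler_addgt0Pr => e e0.
have [|k _ hk] := ul e%:C; first by rewrite ltcR.
have := hk _ (leq_maxl k n); rewrite -rnormC lecR => h1.
rewrite -[l](subrK (u (maxn k n))) -addrA addrC (le_trans (rnormD _ _)) //.
by rewrite lerD // cu // leq_maxr.
Qed.

(* The representing vector minimizes |x|^2 - 2 f(x); minimizing sequences are
   Cauchy by the parallelogram law. *)
Lemma riesz_real (f : H -> R) (M : R) :
    (forall x y, f (x + y) = f x + f y) ->
    (forall a x, f (a%:C *: x) = a * f x) ->
    (forall x, f x <= M * rnorm x) ->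
  exists z, forall x, f x = rdot x z.
Proof.
move=> fD fZ fM.
pose J x := rdot x x - 2 * f x.
pose E := [set J x | x in setT]%classic.
have lbJ : has_lbound E.
  exists (- M ^+ 2) => _ [x _ <-]; rewrite /J -rnorm_sqr.
  have := fM x; have := sqr_ge0 (rnorm x - M); nra.
have mJ x : inf E <= J x by apply: ge_inf => //; exists x.
have E0 : has_inf E by split => //; exists (J 0), 0.
(* The excess is a square so that the parallelogram law, with excess at most [4 / (n + 1)^2], gives
   the distance bound [2 / (n + 1)]. *)
have /choice[u hu] n : exists x, J x < inf E + (n.+1%:R^-1) ^+ 2.
  have [|_ [x _ <-] h] := @inf_adherent _ E (n.+1%:R^-1 ^+ 2) _ E0.
    by rewrite exprn_gt0 ?invr_gt0.
  by exists x.
have inv_le n m : (n <= m)%N -> (m.+1%:R^-1 : R) <= n.+1%:R^-1.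
  by move=> nm; rewrite lef_pV2 ?posrE // ler_nat.
have [|z hz] := @cauchy_rate_limit u 2.
  move=> n m /inv_le nm.
  rewrite -(@ler_pXn2r _ 2) ?nnegrE ?rnorm_ge0 ?divr_ge0 // rnorm_sqr.
  have := mJ (2^-1%:C *: (u m + u n)); have := hu n; have := hu m.
  rewrite /J fZ fD !rdotE (rdotC (u n)) exprMn.
  have : (m.+1%:R^-1 : R) ^+ 2 <= n.+1%:R^-1 ^+ 2.
    by rewrite ler_pXn2r // nnegrE invr_ge0.
  by move: (m.+1%:R^-1 ^+ 2) (n.+1%:R^-1 ^+ 2) => am an; lra.
(* Almost minimality of [u n] along the line [u n + t x] makes a quadratic in [t] nonnegative; its
   discriminant bounds the error. *)
have gap n x : `|rdot x (u n) - f x| <= rnorm x / n.+1%:R.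
  rewrite -(@ler_pXn2r _ 2) ?nnegrE ?divr_ge0 ?rnorm_ge0 //.
  rewrite real_normK ?num_real // exprMn rnorm_sqr.
  apply: discriminant_le => [|t]; first by rewrite -rnorm_sqr sqr_ge0.
  have := mJ (u n + t%:C *: x); have := hu n.
  rewrite /J fD fZ !rdotE (rdotC (u n)); move: (n.+1%:R^-1 ^+ 2) => an; lra.
have close x : `|f x - rdot x z| <= 0.
  (* One part comes from [gap], two from the distance between [z] and [u n]. *)
  apply: (@le0_of_le_div _ _ (3 * rnorm x)) => n.
  have := gap n x; rewrite distrC => h1.
  have h2 : `|rdot x (u n) - rdot x z| <= 2 * rnorm x / n.+1%:R.
    rewrite -rdotNr -rdotDr ler_norml; apply/andP.
    have := rdot_le x (z - u n); have := rdot_ge x (z - u n).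
    have := ler_wpM2l (rnorm_ge0 x) (hz n).
    by rewrite !rdotDr !rdotNr; move: (n.+1%:R^-1) => i; split; lra.
  apply: (le_trans (ler_distD (rdot x (u n)) _ _)).
  by move: h1 h2; move: (n.+1%:R^-1) => i; lra.
by exists z => x; apply/eqP; rewrite -subr_eq0 -normr_le0.
Qed.

(** Turns vector identities into scalar identities in [R[i]], where [ring] applies. *)
Lemma inner_extl x y : (forall z, inner x z = inner y z) -> x = y.
Proof.
move=> xy; apply/subr0_eq/rnorm_eq0.
suff : rnorm (x - y) ^+ 2 = 0 by move/eqP; rewrite expf_eq0 => /eqP ->.
by rewrite rnorm_sqr /rdot linearBl /= xy subrr.
Qed.

Lemma vector0_of_le_div x (K : R) :
  (forall n, rnorm x <= K / n.+1%:R) -> x = 0.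
Proof. by move/le0_of_le_div/rnorm_eq0. Qed.

End RealInnerProduct.

(** * Algebra of linear maps given as plain functions *)

Section LinearFunctions.
Variables (R : realType) (H : hilbertType R) (T : H -> H).
Hypothesis linT : linear T.

Lemma linear_fun0 : T 0 = 0.
Proof.
by have := linT (-1) 0 0; rewrite scaler0 addr0 scaleN1r addNr.
Qed.

Lemma linear_funD x y : T (x + y) = T x + T y.
Proof. by have := linT 1 x y; rewrite !scale1r. Qed.

Lemma linear_funZ (a : R[i]) x : T (a *: x) = a *: T x.
Proof. by have := linT a x 0; rewrite linear_fun0 !addr0. Qed.

Lemma linear_funN x : T (- x) = - T x.
Proof. by rewrite -scaleN1r linear_funZ scaleN1r. Qed.

Lemma linear_funB x y : T (x - y) = T x - T y.
Proof. by rewrite linear_funD linear_funN. Qed.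

End LinearFunctions.

(** * Operator norm and adjoint *)

Section Operators.
Variables (R : realType) (H : hilbertType R).
Implicit Types (x y z : H) (S T P : H -> H).

Lemma bounded_operator_gt0 T : bounded_operator T ->
  exists2 M : R, 0 < M & forall x, rnorm (T x) <= M * rnorm x.
Proof.
move=> [_ [M hM]]; exists (`|M| + 1); first by rewrite ltr_wpDl.
move=> x; apply: le_trans (hM x) _; rewrite ler_wpM2r ?rnorm_ge0 //.
by rewrite (le_trans (ler_norm M)) // lerDl.
Qed.

Lemma opnorm_ge0 T : 0 <= opnorm T.
Proof.
rewrite /opnorm; set E := (X in sup X).
(* For unbounded [T] the supremum takes its default value 0. *)
have [hE|nE] := pselect (has_sup E); last by rewrite sup_out.
apply: le_trans (rnorm_ge0 (T 0)) _; apply: sup_upper_bound => //.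
by exists 0 => //=; rewrite rnorm0.
Qed.

Lemma rnorm_le_opnorm T x :
  bounded_operator T -> rnorm (T x) <= opnorm T * rnorm x.
Proof.
move=> bT; have [linT _] := bT; have [M M0 hM] := bounded_operator_gt0 bT.
have [x0|nx0] := eqVneq (rnorm x) 0.
  by rewrite (@rnorm_eq0 _ _ x) ?x0 // linear_fun0 // rnorm0 mulr0.
have x_gt0 : 0 < rnorm x by rewrite lt0r nx0 rnorm_ge0.
have := @ub_le_sup _ [set rnorm (T x) | x in [set x | rnorm x <= 1]]%classic.
have nV : rnorm ((rnorm x)^-1%:C) = (rnorm x)^-1.
  by rewrite rnorm_real // invr_ge0 rnorm_ge0.
move=> /(_ _ (rnorm (T ((rnorm x)^-1%:C *: x)))) h.
rewrite -ler_pdivrMr // mulrC -nV -rnormZ -linear_funZ //; apply: h.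
  by exists M => _ [y /= y1 <-]; rewrite (le_trans (hM y)) // ler_piMr // ltW.
by exists ((rnorm x)^-1%:C *: x) => //=; rewrite rnormZ nV mulVf.
Qed.

(** Riesz represents the real functional [rdot (T x) y]; complex linearity of [T] then carries the
    identity over to the imaginary part. *)
Lemma adjoint_exists T : bounded_operator T ->
  exists S, bounded_operator S /\ forall x y, inner (T x) y = inner x (S y).
Proof.
move=> bT; have [linT _] := bT; have [M M0 hM] := bounded_operator_gt0 bT.
have /choice[S hS] y : exists z, forall x, rdot (T x) y = rdot x z.
  apply: (@riesz_real _ _ _ (M * rnorm y)) => [u v|a u|u].
  - by rewrite linear_funD // rdotDl.
  - by rewrite linear_funZ // rdotZl.
  - apply: le_trans (rdot_le _ _) _.
    by rewrite mulrAC ler_wpM2r ?rnorm_ge0.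
have adjS x y : inner (T x) y = inner x (S y).
  rewrite !inner_rdot hS; congr (_ +i* _).
  by rewrite -[LHS]opprK -rdotZi -linear_funZ // hS rdotZi opprK.
exists S; split=> //; split=> [a u v|].
  apply: inner_extl => z; rewrite (hermC inner) [RHS](hermC inner).
  by rewrite /= -adjS !linearDr !linearZr_LR /= !adjS.
(* [|S y|^2 = <T (S y), y> <= M |S y| |y|]; one factor [|S y|] cancels unless it is 0. *)
exists M => y; have := hS y (S y); rewrite -rnorm_sqr => Sy.
have := rdot_le (T (S y)) y; rewrite Sy; have := hM (S y).
have := rnorm_ge0 y; have := rnorm_ge0 (S y); rewrite le0r => /orP[/eqP->|].
  by move=> y0 _ _; rewrite mulr_ge0 // ltW.
move=> s0 y0 h1 h2; rewrite -(ler_pM2l s0) -expr2 (le_trans h2) //.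
by rewrite mulrA [_ * M]mulrC ler_wpM2r.
Qed.

Lemma adjointP T : bounded_operator T ->
  bounded_operator (adjoint T) /\
  forall x y, inner (T x) y = inner x (adjoint T y).
Proof. by move/adjoint_exists/(xgetPex 0). Qed.

End Operators.

(** * Square root of [1 - B] for a symmetric contraction [B] *)

Section SquareRoot.
Variables (R : realType) (H : hilbertType R) (B : H -> H).
Hypotheses (linB : linear B) (symB : forall x y, rdot (B x) y = rdot x (B y)).
Hypothesis B_le : forall x, rnorm (B x) <= rnorm x.

(* Started at 0, the iteration L |-> (B + L^2)/2 converges to the solution of
   (1 - L)^2 = 1 - B.  For B = 1 it is the scalar sequence sqrt_bound, which
   increases to 1; its increments bound those of sqrt_iter because
   L^2 - K^2 = L (L - K) + (L - K) K. *)
Fixpoint sqrt_iter n (x : H) : H :=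
  if n is m.+1 then (2^-1 : R)%:C *: (B x + sqrt_iter m (sqrt_iter m x)) else 0.

Fixpoint sqrt_bound n : R :=
  if n is m.+1 then 2^-1 * (1 + sqrt_bound m ^+ 2) else 0.

Local Notation Y := sqrt_iter.
Local Notation y := sqrt_bound.

Lemma sqrt_bound_itv n : 0 <= y n <= 1.
Proof. by elim: n => [|n] /=; nra. Qed.

Lemma sqrt_boundS n : y n <= y n.+1.
Proof. by have := sqr_ge0 (1 - y n) => /=; nra. Qed.

(** The defect [d = 1 - y n] evolves by [d - d^2 / 2], so [1 / d] starts at 1 and grows by at least
    [1 / 2] at each step. *)
Lemma sqrt_bound_rate n : 1 - y n <= 2 / n.+2%:R.
Proof.
elim: n => [|n ih]; first by rewrite /= divff //; lra.
have /andP[y0 y1] := sqrt_bound_itv n.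
move: ih; rewrite !ler_pdivlMr //= -[n.+3]addn1 natrD.
have : 2 <= n.+2%:R :> R by rewrite ler_nat.
move: (n.+2%:R : R) (y n) y0 y1 => k t t0 t1 k2 ih.
nra.
Qed.

Lemma sqrt_iter_linear n : linear (Y n).
Proof.
elim: n => [|n ih] a u v /=; first by rewrite scaler0 addr0.
rewrite linB !ih; apply: inner_extl => z.
by rewrite !(linearDl, linearZl_LR) /=; ring.
Qed.

Lemma sqrt_iter_sym n u v : rdot (Y n u) v = rdot u (Y n v).
Proof.
elim: n u v => [|n ih] u v /=; last by rewrite !rdotE symB !ih.
by rewrite /rdot linear0l linear0r.
Qed.

Lemma rnorm_half (v : H) : rnorm ((2^-1 : R)%:C *: v) = 2^-1 * rnorm v.
Proof. by rewrite rnormZ rnorm_real. Qed.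

Lemma sqrt_iter_le n x : rnorm (Y n x) <= y n * rnorm x.
Proof.
elim: n x => [|n ih] x /=; first by rewrite rnorm0 mul0r.
rewrite rnorm_half -mulrA ler_wpM2l // mulrDl mul1r.
apply: le_trans (rnormD _ _) _; apply: lerD (B_le x) _.
have /andP[y0 _] := sqrt_bound_itv n.
by apply: le_trans (ih _) _; rewrite expr2 -mulrA ler_wpM2l.
Qed.

Lemma sqrt_iter_step n x :
  rnorm (Y n.+1 x - Y n x) <= (y n.+1 - y n) * rnorm x.
Proof.
elim: n x => [|n ih] x; first by rewrite !subr0 sqrt_iter_le.
have -> : Y n.+2 x - Y n.+1 x = (2^-1 : R)%:C *:
    (Y n.+1 (Y n.+1 x - Y n x) + (Y n.+1 (Y n x) - Y n (Y n x))).
  rewrite (linear_funB (sqrt_iter_linear _)) addrA subrK -scalerBr.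
  by rewrite opprD addrACA subrr add0r.
have -> : y n.+2 - y n.+1 = 2^-1 * ((y n.+1 + y n) * (y n.+1 - y n)).
  have yS k : y k.+1 = 2^-1 * (1 + y k ^+ 2) by [].
  by rewrite (yS n.+1) [X in _ - X = _](yS n); ring.
rewrite rnorm_half -mulrA ler_wpM2l //.
have /andP[y0 _] := sqrt_bound_itv n; have /andP[z0 _] := sqrt_bound_itv n.+1.
have d0 : 0 <= y n.+1 - y n by rewrite subr_ge0 sqrt_boundS.
apply: le_trans (rnormD _ _) _; rewrite mulrDl mulrDl; apply: lerD.
  by apply: le_trans (sqrt_iter_le _ _) _; rewrite -mulrA ler_wpM2l.
apply: le_trans (ih _) _; rewrite [y n * _]mulrC -mulrA ler_wpM2l //.
exact: sqrt_iter_le.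
Qed.

Lemma sqrt_iter_cauchy n m x : (n <= m)%N ->
  rnorm (Y m x - Y n x) <= (y m - y n) * rnorm x.
Proof.
move=> /subnKC <-; elim: (m - n)%N => [|k ih].
  by rewrite addn0 !subrr rnorm0 mul0r.
rewrite addnS -[_ - Y n x](subrKA (Y (n + k) x)) -[_ - y n](subrKA (y (n + k))).
by rewrite mulrDl; apply: le_trans (rnormD _ _) (lerD (sqrt_iter_step _ _) ih).
Qed.

(** The increments telescope to [y m - y n <= 1 - y n], so the scalar rate passes to the
    operators. *)
Lemma sqrt_iter_limit : exists L : H -> H,
  forall x n, rnorm (L x - Y n x) <= 2 * rnorm x / n.+1%:R.
Proof.
suff /choice[L] : forall x, exists l : H,
    forall n, rnorm (l - Y n x) <= 2 * rnorm x / n.+1%:R by exists L.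
move=> x; apply: cauchy_rate_limit => n m nm.
apply: le_trans (sqrt_iter_cauchy _ nm) _.
rewrite mulrAC ler_wpM2r ?rnorm_ge0 //.
have /andP[_ ym] := sqrt_bound_itv m.
apply: (@le_trans _ _ (1 - y n)); first by rewrite lerB.
apply: le_trans (sqrt_bound_rate n) _.
by rewrite ler_wpM2l // lef_pV2 ?posrE // ler_nat.
Qed.

(** Each property holds for the iterates, exactly or up to an index shift, and the error of
    replacing [L] by [Y n] is a multiple of [1 / (n + 1)]. *)
Lemma sqrt_fixpoint_exists : exists L : H -> H,
  [/\ linear L, forall u v, rdot (L u) v = rdot u (L v),
      forall x, rnorm (L x) <= rnorm x &
      forall x, L x + L x = B x + L (L x)].
Proof.
have [L hL] := sqrt_iter_limit; exists L.
have Lle x : rnorm (L x) <= rnorm x.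
  rewrite -subr_le0; apply: (@le0_of_le_div _ _ (2 * rnorm x)) => n.
  rewrite lerBlDr -{1}[L x](subrK (Y n x)) (le_trans (rnormD _ _)) // lerD //.
  have /andP[_ yn] := sqrt_bound_itv n.
  by rewrite (le_trans (sqrt_iter_le _ _)) // ler_piMl // rnorm_ge0.
split=> // [a u v|u v|x].
- apply/subr0_eq.
  pose K := 2 * rnorm (a *: u + v) + rnorm a * (2 * rnorm u) + 2 * rnorm v.
  apply: (@vector0_of_le_div _ _ _ K) => n.
  have -> : L (a *: u + v) - (a *: L u + L v) =
      (L (a *: u + v) - Y n (a *: u + v)) + - (a *: (L u - Y n u)) +
      - (L v - Y n v).
    rewrite sqrt_iter_linear; apply: inner_extl => z.
    by rewrite !(linearDl, linearNl, linearZl_LR) /=; ring.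
  rewrite /K [X in _ <= X]mulrDl [X in _ <= X + _]mulrDl.
  apply: le_trans (rnormD _ _) (lerD (le_trans (rnormD _ _) (lerD _ _)) _) => //.
    by rewrite rnormN rnormZ -mulrA ler_wpM2l ?rnorm_ge0.
  by rewrite rnormN.
- apply/eqP; rewrite -subr_eq0 -normr_le0.
  apply: (@le0_of_le_div _ _ (4 * rnorm u * rnorm v)) => n.
  have -> : rdot (L u) v - rdot u (L v) =
      rdot (L u - Y n u) v - rdot u (L v - Y n v).
    by rewrite !rdotE sqrt_iter_sym; ring.
  have := rdot_le (L u - Y n u) v; have := rdot_ge (L u - Y n u) v.
  have := rdot_le u (L v - Y n v); have := rdot_ge u (L v - Y n v).
  have := ler_wpM2r (rnorm_ge0 v) (hL u n).
  have := ler_wpM2l (rnorm_ge0 u) (hL v n).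
  rewrite ler_norml; move: (n.+1%:R^-1) => i h1 h2 h3 h4 h5 h6.
  by apply/andP; split; lra.
apply/subr0_eq; apply: (@vector0_of_le_div _ _ _ (8 * rnorm x)) => n.
set e := 2 * rnorm x / n.+1%:R.
have inv_le : n.+2%:R^-1 <= n.+1%:R^-1 :> R by rewrite lef_pV2 ?posrE // ler_nat.
have e1 : rnorm (L x - Y n.+1 x) <= e.
  by apply: le_trans (hL _ _) _; rewrite ler_wpM2l ?mulr_ge0 ?rnorm_ge0.
have e2 : rnorm (L (L x) - Y n (L x)) <= e.
  apply: le_trans (hL _ _) _; rewrite ler_wpM2r ?invr_ge0 //.
  by rewrite ler_wpM2l.
have e3 : rnorm (Y n (L x - Y n x)) <= e.
  apply: le_trans (sqrt_iter_le _ _) _; have /andP[y0 y1] := sqrt_bound_itv n.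
  by apply: le_trans (hL x n); rewrite ler_piMl // rnorm_ge0.
(* Subtract the recursion [2 Y (n + 1) x = B x + Y n (Y n x)] and split [L (L x) - Y n (Y n x)] at
   [Y n (L x)]. Each of the four terms is at most [e]. *)
have -> : L x + L x - (B x + L (L x)) =
    (L x - Y n.+1 x) + (L x - Y n.+1 x) + - (L (L x) - Y n (L x)) +
    - Y n (L x - Y n x).
  rewrite (linear_funB (sqrt_iter_linear n)) /=.
  have c2 : (2^-1 : R)%:C + (2^-1 : R)%:C = 1.
    by rewrite -rmorphD -[RHS]/(1%:C); congr (_ %:C); field.
  rewrite [X in _ = X - _ - _]addrACA -opprD -scalerDl c2 scale1r.
  by apply: inner_extl => z; rewrite !(linearDl, linearNl) /=; ring.
have -> : 8 * rnorm x / n.+1%:R = e + e + e + e by rewrite /e; ring.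
apply: le_trans (rnormD _ _) (lerD (le_trans (rnormD _ _)
  (lerD (le_trans (rnormD _ _) (lerD e1 e1)) _)) _) => //.
  by rewrite rnormN.
by rewrite rnormN.
Qed.

(** Take [P = 1 - L]: the fixed point equation gives [1 - 2 L + L^2 = 1 - B], and [P] is positive
    because [L] is a contraction. *)
Lemma sqrt_id_sub_exists : exists P : H -> H,
  [/\ linear P, forall u v, rdot (P u) v = rdot u (P v),
      forall x, rnorm (P x) <= 2 * rnorm x,
      forall x, 0 <= rdot (P x) x &
      forall x, P (P x) = x - B x].
Proof.
have [L [linL symL Lle Lfix]] := sqrt_fixpoint_exists.
exists (fun x => x - L x); split=> [a u v|u v|x|x|x].
- rewrite linL scalerBr; apply: inner_extl => z.
  by rewrite !(linearDl, linearNl, linearZl_LR) /=; ring.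
- by rewrite !rdotE symL.
- by apply: le_trans (rnormD _ _) _; rewrite rnormN; have := Lle x; lra.
- rewrite !rdotE -rnorm_sqr; have := rdot_le (L x) x.
  by have := ler_wpM2r (rnorm_ge0 x) (Lle x); rewrite expr2; lra.
- rewrite linear_funB // -[B x](addrK (L (L x))) -Lfix.
  by apply: inner_extl => z; rewrite !(linearDl, linearNl) /=; ring.
Qed.

End SquareRoot.

(** * Positive operators, existence of the absolute value and the pointwise estimate *)

Section AbsoluteValue.
Variables (R : realType) (H : hilbertType R).
Implicit Types (x y z : H) (S T P : H -> H).

Lemma rdot_adjoint T x y :
  bounded_operator T -> rdot (T x) y = rdot x (adjoint T y).
Proof. by case/adjointP => _ adjT; rewrite /rdot adjT. Qed.

(** Keeps the constant [N], so that the norm of [T] also serves as a bound for [adjoint T]. *)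
Lemma adjoint_le T (N : R) : 0 <= N -> bounded_operator T ->
  (forall x, rnorm (T x) <= N * rnorm x) ->
  forall x, rnorm (adjoint T x) <= N * rnorm x.
Proof.
move=> N0 bT TN y; set s := rnorm (adjoint T y).
have := rdot_le (T (adjoint T y)) y; rewrite rdot_adjoint // -rnorm_sqr -/s.
have := rnorm_ge0 (adjoint T y); rewrite -/s le0r => /orP[/eqP->|s0] h.
  by rewrite mulr_ge0 ?rnorm_ge0.
rewrite -(ler_pM2l s0) -expr2 (le_trans h) // mulrA [s * N]mulrC.
by rewrite ler_wpM2r ?rnorm_ge0.
Qed.

(** Multiplication by [i] is skew for [rdot] and commutes with [P]; symmetry then makes the
    imaginary part of [<P x, x>] equal to its own negative. *)
Lemma positive_operatorP P : linear P ->
    (forall x y, rdot (P x) y = rdot x (P y)) ->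
    (exists M : R, forall x, rnorm (P x) <= M * rnorm x) ->
    (forall x, 0 <= rdot (P x) x) -> positive_operator P.
Proof.
move=> linP symP bP P0; split=> // x; rewrite inner_rdot lecE /= P0 andbT.
have := rdotZi (P x) x; rewrite -linear_funZ // symP rdotC => h.
by apply/eqP; lra.
Qed.

(** Polarization: the imaginary part of [<P z, z>] vanishes, and at [z = x + i y] its cross terms
    are the two sides. *)
Lemma positive_operator_sym P x y :
  positive_operator P -> rdot (P x) y = rdot x (P y).
Proof.
move=> [[linP _] P0].
have im0 z : rdot (P z) ('i *: z) = 0.
  by have := P0 z; rewrite inner_rdot lecE /= => /andP[/eqP].
have := im0 (x + ('i : R[i]) *: y).
rewrite (linear_funD linP) (linear_funZ linP) scalerDr !scalerA -expr2 sqr_i scaleN1r.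
rewrite !rdotE im0 rdotZi scalerA -expr2 sqr_i scaleN1r rdotNr rdotZi im0.
by rewrite (rdotC x); lra.
Qed.

Lemma rdot_adjoint_comp T x : bounded_operator T ->
  rdot ((adjoint T \o T) x) x = rnorm (T x) ^+ 2.
Proof. by move=> bT; rewrite /= rdotC -rdot_adjoint // rnorm_sqr. Qed.

Lemma sqrt_adjoint_comp_exists T : bounded_operator T ->
  exists P, positive_operator P /\ P \o P = adjoint T \o T.
Proof.
move=> bT; have [[linA _] _] := adjointP bT; have [linT _] := bT.
have [M M0 TM] := bounded_operator_gt0 bT.
have AM := adjoint_le (ltW M0) bT TM.
pose c : R[i] := (M^-1 ^+ 2)%:C.
pose D x := c *: adjoint T (T x).
have D_dot x y : rdot (D x) y = M^-1 ^+ 2 * rdot (T x) (T y).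
  by rewrite rdotZl rdotC -rdot_adjoint // rdotC.
have D_norm x : rnorm (D x) <= M^-1 * rnorm (T x).
  rewrite rnormZ rnorm_real ?sqr_ge0 // expr2 -mulrA ler_wpM2l ?invr_ge0 ?(ltW M0) //.
  by rewrite ler_pdivrMl.
pose B x := x - D x.
(* A square root of M^-2 T^* T = 1 - B, rescaled by M.  The operator B is a
   contraction since |D x|^2 <= <D x, x>. *)
have [a u v|u v|x|P [linP symP P2 P0 PP]] := @sqrt_id_sub_exists R H B.
- rewrite /B /D linT // linA; apply: inner_extl => z.
  by rewrite !(linearDl, linearNl, linearZl_LR) /=; ring.
- by rewrite !(rdotDl, rdotDr, rdotNl, rdotNr) D_dot (rdotC u (D v)) D_dot (rdotC (T v)).
- rewrite -(@ler_pXn2r _ 2) ?nnegrE ?rnorm_ge0 // !rnorm_sqr.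
  rewrite !(rdotDl, rdotDr, rdotNl, rdotNr).
  (* The square of [D_norm]; by [D_dot] the right side is [<D x, x>]. *)
  have D2 : rdot (D x) (D x) <= M^-1 ^+ 2 * rdot (T x) (T x).
    rewrite -!rnorm_sqr -exprMn ler_pXn2r ?nnegrE ?mulr_ge0 ?rnorm_ge0 //.
    by rewrite invr_ge0 ltW.
  have : 0 <= rdot (D x) (D x) by rewrite -rnorm_sqr sqr_ge0.
  have := D_dot x x; rewrite (rdotC x (D x)); lra.
exists (fun x => M%:C *: P x); split.
  apply: positive_operatorP => [a u v|u v||x].
  - rewrite linP; apply: inner_extl => z.
    by rewrite !(linearDl, linearNl, linearZl_LR) /=; ring.
  - by rewrite !rdotE symP.
  - exists (M * 2) => x; rewrite rnormZ rnorm_real ?(ltW M0) // -mulrA.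
    by rewrite ler_wpM2l ?(ltW M0).
  - by rewrite rdotZl mulr_ge0 // ltW.
apply/funext => x /=; rewrite linear_funZ // PP /B opprB addrC subrK scalerA.
rewrite /D scalerA /c -!rmorphM /= -expr2 exprVn divff ?scale1r //.
by rewrite expf_neq0 // gt_eqF.
Qed.

(** With [P] the chosen root, symmetry gives [|P x|^2 = <P (P x), x> = <adjoint T (T x), x> = |T
    x|^2]. *)
Lemma abs_operatorP T : bounded_operator T ->
  positive_operator (abs_operator T) /\
  forall x, rnorm (abs_operator T x) = rnorm (T x).
Proof.
move=> bT; have [posP PP] := xgetPex 0 (sqrt_adjoint_comp_exists bT).
split=> // x; apply/eqP; rewrite -(@eqrXn2 _ 2) ?rnorm_ge0 //; apply/eqP.
rewrite -(rdot_adjoint_comp x bT) -PP rnorm_sqr /=.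
by rewrite (positive_operator_sym _ x posP).
Qed.

(** Stated for any bound [N], so that it applies to [T] and to [adjoint T] with the same
    constant. *)
Lemma rnorm_sqr_le_abs_operator T (N : R) x : 0 <= N -> bounded_operator T ->
  (forall y, rnorm (T y) <= N * rnorm y) ->
  rnorm (T x) ^+ 2 <= N * rdot (abs_operator T x) x.
Proof.
move=> N0 bT TN; have [posP nP] := abs_operatorP bT.
set P := abs_operator T in posP nP *; have [[linP _] P0] := posP.
have {}P0 y : 0 <= rdot (P y) y.
  by have := P0 y; rewrite inner_rdot lecE /= => /andP[].
(* Cauchy-Schwarz for the semidefinite form <P u, v> at u = x, v = P x. *)
have cs : rdot (P x) (P x) ^+ 2 <= rdot (P x) x * rdot (P (P x)) (P x).
  apply: discriminant_le => // t; have := P0 (t%:C *: x + P x).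
  rewrite linear_funD // linear_funZ // !rdotE.
  by rewrite (positive_operator_sym (P x) x posP); congr (_ <= _); ring.
have PPx : rdot (P (P x)) (P x) <= N * rdot (P x) (P x).
  apply: le_trans (rdot_le _ _) _; rewrite nP -rnorm_sqr expr2 mulrA.
  by rewrite ler_wpM2r ?rnorm_ge0.
rewrite -nP rnorm_sqr; have : 0 <= rdot (P x) (P x) by rewrite -rnorm_sqr sqr_ge0.
(* With [s = |P x|^2], the two bounds give [s^2 <= <P x, x> N s]; divide by [s] if it is
   positive. *)
rewrite le0r => /orP[/eqP->|s0]; first by rewrite mulr_ge0.
rewrite -(ler_pM2r s0) -expr2 (le_trans cs) //.
by rewrite [N * _]mulrC -mulrA ler_wpM2l.
Qed.

End AbsoluteValue.

(** * From unit vectors to the numerical radius *)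

Theorem theorem2p8 (R : realType) (H : hilbertType R) (T : H -> H)
    (hT : bounded_operator T) (alpha : R) (halpha : 0 <= alpha <= 1) :
  numerical_radius T ^+ 2 <=
    opnorm (alpha%:C *: abs_operator T
            + (1 - alpha)%:C *: abs_operator (adjoint T)) * opnorm T.
Proof.
have [bA adjT] := adjointP hT; have /andP[a0 a1] := halpha.
set S := (X in opnorm X); set N := opnorm T.
have N0 : 0 <= N by exact: opnorm_ge0.
have TN x : rnorm (T x) <= N * rnorm x by exact: rnorm_le_opnorm.
have AN := adjoint_le N0 hT TN.
have [[[linP _] _] nP] := abs_operatorP hT.
have [[[linQ _] _] nQ] := abs_operatorP bA.
have b0 : 0 <= 1 - alpha by rewrite subr_ge0.
have bS : bounded_operator S.
  split=> [c u v|].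
    rewrite /S !fctE linP linQ; apply: inner_extl => z.
    by rewrite !(linearDl, linearZl_LR) /=; ring.
  exists (alpha * N + (1 - alpha) * N) => x; rewrite /S !fctE mulrDl.
  apply: le_trans (rnormD _ _) (lerD _ _); rewrite rnormZ rnorm_real // -mulrA.
    by rewrite nP ler_wpM2l.
  by rewrite nQ ler_wpM2l.
have C0 : 0 <= opnorm S * N by rewrite mulr_ge0 ?opnorm_ge0.
pose E := [set rnorm (inner (T x) x) | x in [set x | rnorm x = 1]]%classic.
(* The square root turns the bound on squares into an upper bound of [E] itself, suited to a
   supremum. *)
have E_le v : E v -> v <= Num.sqrt (opnorm S * N).
  move=> [x /= x1 <-].
  rewrite -(@ler_pXn2r _ 2) ?nnegrE ?sqrtr_ge0 ?rnorm_ge0 // sqr_sqrtr //.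
  have hP : rnorm (inner (T x) x) ^+ 2 <= N * rdot (abs_operator T x) x.
    apply: le_trans (rnorm_sqr_le_abs_operator x N0 hT TN).
    rewrite ler_pXn2r ?nnegrE ?rnorm_ge0 //.
    by have := rnorm_inner_le (T x) x; rewrite x1 mulr1.
  have hQ : rnorm (inner (T x) x) ^+ 2 <= N * rdot (abs_operator (adjoint T) x) x.
    apply: le_trans (rnorm_sqr_le_abs_operator x N0 bA AN).
    rewrite ler_pXn2r ?nnegrE ?rnorm_ge0 // adjT.
    by have := rnorm_inner_le x (adjoint T x); rewrite x1 mul1r.
  have hS : rdot (S x) x <= opnorm S.
    apply: le_trans (rdot_le _ _) _; rewrite x1 mulr1.
    by have := rnorm_le_opnorm x bS; rewrite x1 mulr1.
  apply: le_trans (ler_wpM2r N0 hS).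
  rewrite /S !fctE !rdotE.
  have := ler_wpM2l a0 hP; have := ler_wpM2l b0 hQ; lra.
rewrite -(sqr_sqrtr C0) ler_pXn2r ?nnegrE ?sqrtr_ge0 //; rewrite /numerical_radius -/E.
  (* An empty [E], as for [H = {0}], has supremum 0 by default. *)
  have [[v Ev]|] := pselect (E !=set0)%classic; first by apply: ge_sup E_le; exists v.
  by move/set0P/negP/negPn/eqP => ->; rewrite sup0 sqrtr_ge0.
(* Comparing squares also required the numerical radius to be nonnegative. *)
have [hE|nE] := pselect (has_sup E); last by rewrite sup_out.
case: (hE) => -[v Ev] _; apply: le_trans (sup_upper_bound hE Ev).
by case: Ev => x _ <-; exact: rnorm_ge0.
Qed.
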